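(* Let $P$ be the transition probability matrix of an irreducible random walk on $\mathbb{Z}$, with entries $P_{n,n+1}=a_n$, $P_{n,n}=b_n$, $P_{n,n-1}=c_n$, and let $\Psi$ be its $2\times 2$ spectral matrix. Let $P=P_UP_L$ be a stochastic UL factorization with coefficients $x_n,y_n,s_n,r_n$ ($n\in\mathbb{Z}$), and let $\widetilde P=P_LP_U$ be the transition probability matrix of the corresponding Darboux random walk, with coefficients $\tilde a_n,\tilde b_n,\tilde c_n$ (all as described in the context). Assume that $M_{-1}=\int_{-1}^{1}\frac{\Psi(x)}{x}\,dx$ is well defined (entry by entry). Then the polynomials $(\widetilde Q_n^\alpha)_{n\in\mathbb{Z}}$, $\alpha=1,2$, associated with $\widetilde P$ are orthogonal with respect to the spectral matrix $$\widetilde\Psi(x)=\boldsymbol S_0(x)\,\Psi_S(x)\,\boldsymbol S_0^*(x),\qquad \boldsymbol S_0(x)=\begin{pmatrix} s_0& r_0\\ -\dfrac{x_{-1}s_0}{y_{-1}} & \dfrac{x-x_{-1}r_0}{y_{-1}}\end{pmatrix},$$ where $$\Psi_S(x)=\frac{y_0}{s_0}\frac{\Psi(x)}{x}+\left[\begin{pmatrix}1/s_0&0\\0&1/r_0\end{pmatrix}-\frac{y_0}{s_0}M_{-1}\right]\delta_0(x).$$ Moreover, for all $n,m\ge 0$, $$\int_{-1}^{1}\widetilde{\boldsymbol Q}_n(x)\,\widetilde\Psi(x)\,\widetilde{\boldsymbol Q}_m^*(x)\,dx=\begin{pmatrix}1/\tilde\pi_n&0\\0&1/\tilde\pi_{-n-1}\end{pmatrix}\delta_{n,m},\qquad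 \widetilde{\boldsymbol Q}_n(x)=\begin{pmatrix}\widetilde Q_n^1(x)&\widetilde Q_n^2(x)\\ \widetilde Q_{-n-1}^1(x)&\widetilde Q_{-n-1}^2(x)\end{pmatrix},$$ where $(\tilde\pi_n)_{n\in\mathbb{Z}}$ are the potential coefficients of $\widetilde P$.
   Context: Random walk. $a_n+b_n+c_n=1$, $b_n\ge0$, $0<a_n,c_n<1$ for all $n\in\mathbb{Z}$. Polynomials and spectral matrix of $P$. For $\alpha=1,2$ the polynomials $(Q_n^\alpha)_{n\in\mathbb{Z}}$ are defined by $Q_0^1=1$, $Q_0^2=0$, $Q_{-1}^1=0$, $Q_{-1}^2=1$ and $xQ_n^\alpha(x)=a_nQ_{n+1}^\alpha(x)+b_nQ_n^\alpha(x)+c_nQ_{n-1}^\alpha(x)$ for $n\in\mathbb{Z}$. The potential coefficients of $P$ are $\pi_0=1$, $\pi_n=\frac{a_0\cdots a_{n-1}}{c_1\cdots c_n}$, $\pi_{-n}=\frac{c_0c_{-1}\cdots c_{-n+1}}{a_{-1}\cdots a_{-n}}$, $n\ge1$. $P$ defines a self-adjoint operator of norm $\le1$ on $\ell^2_\pi(\mathbb{Z})$, and there exist unique measures $\psi_{11},\psi_{22}$ (positive) and $\psi_{12}=\psi_{21}$ (signed) on $[-1,1]$ such that $\sum_{\alpha,\beta=1}^2\int_{-1}^1Q_i^\alpha Q_j^\beta\,d\psi_{\alpha\beta}=\delta_{i,j}/\pi_j$ for all $i,j\in\mathbb{Z}$. For simplicity these measures are assumed to have densities, $d\psi_{\alpha\beta}(x)=\psi_{\alpha\beta}(x)\,dx$,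 and the spectral matrix is $\Psi(x)=\begin{pmatrix}\psi_{11}(x)&\psi_{12}(x)\\ \psi_{12}(x)&\psi_{22}(x)\end{pmatrix}$. Here $\delta_0(x)$ is the Dirac mass at $0$ (so $\Psi_S(x)\,dx$ and $\widetilde\Psi(x)\,dx$ are matrix-valued measures), $\delta_{n,m}$ is the Kronecker delta, and $A^*$ is the Hermitian transpose of $A$ (for real $x$). Stochastic UL factorization. $P=P_UP_L$ with $P_U,P_L$ stochastic, $(P_U)_{n,n}=y_n$, $(P_U)_{n,n+1}=x_n$, $(P_L)_{n,n}=s_n$, $(P_L)_{n,n-1}=r_n$, all other entries $0$; thus $x_n+y_n=1$, $s_n+r_n=1$, $a_n=x_ns_{n+1}$, $b_n=x_nr_{n+1}+y_ns_n$, $c_n=y_nr_n$ for $n\in\mathbb{Z}$, and $0<x_n,y_n,s_n,r_n<1$. Darboux transformation. $\widetilde P=P_LP_U$ is tridiagonal and stochastic, with $\widetilde P_{n,n+1}=\tilde a_n=s_nx_n$, $\widetilde P_{n,n}=\tilde b_n=r_nx_{n-1}+s_ny_n$, $\widetilde P_{n,n-1}=\tilde c_n=r_ny_{n-1}$. The polynomials $\widetilde Q_n^\alpha$ are defined by $\widetilde Q_0^1=1$, $\widetilde Q_0^2=0$, $\widetilde Q_{-1}^1=0$, $\widetilde Q_{-1}^2=1$ and $x\widetilde Q_n^\alpha(x)=\tilde a_n\widetilde Q_{n+1}^\alpha(x)+\tilde b_n\widetilde Q_n^\alpha(x)+\tilde c_n\widetilde Q_{n-1}^\alpha(x)$, $n\in\mathbb{Z}$,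 $\alpha=1,2$. (Equivalently, $\widetilde{\boldsymbol Q}_n(x)=\boldsymbol S_n(x)\boldsymbol S_0^{-1}(x)$, where $\boldsymbol S_n=\begin{pmatrix}S_n^1&S_n^2\\S_{-n-1}^1&S_{-n-1}^2\end{pmatrix}$ and $S_n^\alpha=s_nQ_n^\alpha+r_nQ_{n-1}^\alpha$.) The potential coefficients of $\widetilde P$ are $\tilde\pi_0=1$, $\tilde\pi_n=\frac{\tilde a_0\cdots\tilde a_{n-1}}{\tilde c_1\cdots\tilde c_n}$, $\tilde\pi_{-n}=\frac{\tilde c_0\cdots\tilde c_{-n+1}}{\tilde a_{-1}\cdots\tilde a_{-n}}$, $n\ge1$. *)

(* Defs.v *)
From HB Require Import structures.
From mathcomp Require Import all_boot all_order all_algebra.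
From mathcomp Require Import all_classical all_reals all_analysis.
Set Implicit Arguments.
Unset Strict Implicit.
Unset Printing Implicit Defensive.
Import Order.TTheory GRing.Theory Num.Theory.
Local Open Scope classical_set_scope.
Local Open Scope ring_scope.

Section Walks.
Variable R : realType.
Implicit Types (a b c x y r s : int -> R) (A B P : int -> int -> R).

Definition tridiag a b c : int -> int -> R := fun i j =>
  if j == i + 1 then a i
  else if j == i then b i
  else if j == i - 1 then c i
  else 0.

(* The sum over the integers is a finitely supported one: it is the matrix
   product whenever each row of A (or column of B) has finite support. *)
Definition mulZ A B : int -> int -> R := fun i j =>
  \sum_(k \in [set: int]) A i k * B k j.

Definition random_walk a b c : Prop := forall n : int,
  [/\ a n + b n + c n = 1, 0 <= b n, 0 < a n < 1 & 0 < c n < 1].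

Definition PU y x : int -> int -> R := tridiag x y (fun=> 0).
Definition PL s r : int -> int -> R := tridiag (fun=> 0) s r.

Definition stochastic_UL P x y s r : Prop :=
  [/\ forall n, x n + y n = 1 /\ s n + r n = 1,
      forall n, [/\ 0 < x n < 1, 0 < y n < 1, 0 < s n < 1 & 0 < r n < 1]
    & forall i j, P i j = mulZ (PU y x) (PL s r) i j].

Definition darboux x y s r : int -> int -> R := mulZ (PL s r) (PU y x).

(* Q 0 n and Q 1 n stand for the polynomials with superscripts 1 and 2. *)
Definition walk_polys P (Q : 'I_2 -> int -> {poly R}) : Prop :=
  [/\ Q 0 0 = 1 /\ Q 1 0 = 0,
      Q 0 (-1) = 0 /\ Q 1 (-1) = 1
    & forall (alpha : 'I_2) (n : int),
        'X * Q alpha n = P n (n + 1) *: Q alpha (n + 1) +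
                         P n n *: Q alpha n +
                         P n (n - 1) *: Q alpha (n - 1)].

(* Negz m is the integer - m.+1. *)
Definition potential P (n : int) : R :=
  match n with
  | Posz m => (\prod_(0 <= k < m) P k%:Z (k%:Z + 1)) /
              (\prod_(1 <= k < m.+1) P k%:Z (k%:Z - 1))
  | Negz m => (\prod_(0 <= k < m.+1) P (- k%:Z) (- k%:Z - 1)) /
              (\prod_(1 <= k < m.+2) P (- k%:Z) (- k%:Z + 1))
  end.

Definition mx2 (a b c d : R) : 'M[R]_2 :=
  \matrix_(i, j) if i == 0 then (if j == 0 then a else b)
                 else (if j == 0 then c else d).

Definition I11 : set R := `[-1, 1]%classic.

(* The 2 x 2 matrix-valued measure ac(x) dx + at0 delta_0(x) on [-1, 1]. *)
Record mxmeasure := MxMeasure { ac : R -> 'M[R]_2 ; at0 : 'M[R]_2 }.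
Implicit Type W : mxmeasure.

Definition integral_entry W (i j : 'I_2) (f : R -> R) : R :=
  \int[lebesgue_measure]_(t in I11) (f t * ac W t i j) +
  (\int[\d_(0 : R)]_(t in I11) f t) * at0 W i j.

Definition mxintegral W : 'M[R]_2 :=
  \matrix_(i, j) integral_entry W i j (fun=> 1).

(* The matrix measure A W B^*; as A and B are real, B^* is B^T, and
   A(x) (K delta_0(x)) B(x)^* = A(0) K B(0)^* delta_0(x). *)
Definition mxsandwich (A : R -> 'M[R]_2) W (B : R -> 'M[R]_2) : mxmeasure :=
  MxMeasure (fun t => A t *m ac W t *m (B t)^T) (A 0 *m at0 W *m (B 0)^T).

(* Integrating the indicator of A against a diagonal entry gives the measure of
   A, so the third clause says that the diagonal entries are positive measures. *)
Definition spectral_matrix (p : int -> R) (Q : 'I_2 -> int -> {poly R}) W :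
    Prop :=
  [/\ forall i j : 'I_2, lebesgue_measure.-integrable I11
        (fun t => (ac W t i j)%:E),
      (forall t, I11 t -> (ac W t)^T = ac W t) /\ (at0 W)^T = at0 W,
      forall (i : 'I_2) (A : set R), measurable A ->
        0 <= integral_entry W i i \1_A
    & forall i j : int,
        \sum_(alpha < 2) \sum_(beta < 2)
          integral_entry W alpha beta
            (fun t => (Q alpha i).[t] * (Q beta j).[t]) =
        (i == j)%:R / p j].

Definition Qmx (Q : 'I_2 -> int -> {poly R}) (n : int) (t : R) : 'M[R]_2 :=
  mx2 (Q 0 n).[t] (Q 1 n).[t] (Q 0 (- n - 1)).[t] (Q 1 (- n - 1)).[t].

Definition S0 x y s r (t : R) : 'M[R]_2 :=
  mx2 (s 0) (r 0)
      (- (x (-1) * s 0 / y (-1))) ((t - x (-1) * r 0) / y (-1)).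

Definition Mneg1 (Psi : R -> 'M[R]_2) : 'M[R]_2 :=
  \matrix_(i, j) \int[lebesgue_measure]_(t in I11) (Psi t i j / t).

Definition PsiS y s r (Psi : R -> 'M[R]_2) : mxmeasure :=
  MxMeasure (fun t => (y 0 / s 0) *: (t^-1 *: Psi t))
            (mx2 (1 / s 0) 0 0 (1 / r 0) - (y 0 / s 0) *: Mneg1 Psi).

Definition Psi_tilde x y s r (Psi : R -> 'M[R]_2) : mxmeasure :=
  mxsandwich (S0 x y s r) (PsiS y s r Psi) (S0 x y s r).

End Walks.

(* Main.v *)
(** Let S_n = s_n Q_n + r_n Q_(n-1), row vectors of polynomials.  From
    P = P_U P_L one gets x Q_n = y_n S_n + x_n S_(n+1), and S_n = Qt_n S_0(x)
    since both sides satisfy the recurrence of P_L P_U with the same data at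
    n = 0, -1.  The measure Psi_S is such that integrating a multiple x q of x
    gives y_0/s_0 times the integral of q against Psi, while integrating 1 gives
    diag(1/s_0, 1/r_0).  So the Gram matrix G of (S_n) for Psi_S satisfies a
    first-order recurrence y_n G(n,m) + x_n G(n+1,m) = known, is symmetric, and
    G(0,0) = s_0 + r_0 = 1: it is the diagonal matrix of the 1/pt_n.

    Positivity of the diagonal entries of the new spectral matrix is not visible
    on its density, which has a factor 1/x on [-1,1].  Orthogonality, together
    with pt_n > 0, makes the integral of every square q^2 nonnegative.  Squares
    of the polynomials (1 - ((t-c)^2/4)^n)^(K^n) converge boundedly to the
    indicator of the ball of centre c and radius 2/sqrt K, so Lebesgue
    differentiation gives a density nonnegative almost everywhere; the squares
    of (1 - t^2)^n isolate the atom at 0. *)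
Require Import Defs.
From mathcomp Require Import all_boot all_order all_algebra.
From mathcomp Require Import all_classical all_reals all_analysis.
From mathcomp Require Import measurable_realfun ring lra zify.
Set Implicit Arguments.
Unset Strict Implicit.
Unset Printing Implicit Defensive.
Import Order.TTheory GRing.Theory Num.Theory.
Import numFieldNormedType.Exports.
Local Open Scope classical_set_scope.
Local Open Scope ring_scope.

(** * Measures that are nonnegative on squares of polynomials *)

Section Analysis.
Variable R : realType.
Implicit Types (f g : R -> R) (p q : {poly R}).
Local Notation mu := (@lebesgue_measure R).
Local Notation I := (@I11 R).

Lemma measurable_I11 : measurable I.
Proof. exact: measurable_itv. Qed.

Lemma bounded_horner p : [bounded p.[t] | t in I].
Proof.
have cpI : {within I, continuous (fun t : R => p.[t])}.
  by apply: continuous_subspaceT; exact: continuous_horner.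
have := continuous_compact cpI (@segment_compact R (-1) 1).
by move=> /compact_bounded; rewrite /bounded_set /= => -[M [Mr HM]]; exists M;
  split => // x /HM Hx t It /=; apply: Hx; exists t.
Qed.

Lemma integrable_bounded f g : mu.-integrable I (EFin \o g) ->
  measurable_fun I f -> [bounded f t | t in I] ->
  mu.-integrable I (EFin \o (fun t => f t * g t)).
Proof.
move=> ig mf bf.
have := @integrableMr _ _ _ mu _ (@measurable_I11) _ _ mf bf ig.
by congr integrable; apply/funext => t /=; rewrite EFinM.
Qed.

Lemma integrable_horner p g : mu.-integrable I (EFin \o g) ->
  mu.-integrable I (EFin \o (fun t => p.[t] * g t)).
Proof.
move=> ig; apply: integrable_bounded => //; first exact: measurable_poly.
exact: bounded_horner.
Qed.

Lemma integrable_indic_mul (A : set R) g : measurable A ->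
  mu.-integrable I (EFin \o g) ->
  mu.-integrable I (EFin \o (fun t => \1_A t * g t)).
Proof.
move=> mA ig; apply: integrable_bounded => //.
exists 1; split => // M M1 t _ /=; rewrite indicE; apply: le_trans (ltW M1).
by case: (t \in A); rewrite ?normr1 ?normr0.
Qed.

(** Dominated convergence with majorant [|g|]. The limit is only asked almost everywhere, because
    the polynomials used below are uncontrolled at finitely many points. *)
Lemma Rintegral_cvg_bounded (f_ : nat -> R -> R) f g :
  mu.-integrable I (EFin \o g) ->
  (forall n, measurable_fun I (f_ n)) -> measurable_fun I f ->
  (forall n t, I t -> `|f_ n t| <= 1) ->
  {ae mu, forall t, I t -> f_ n t @[n --> \oo] --> f t} ->
  \int[mu]_(t in I) (f_ n t * g t) @[n --> \oo]
    --> \int[mu]_(t in I) (f t * g t).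
Proof.
move=> ig mf_ mf fb ff.
have mI := measurable_I11.
have mg : measurable_fun I g by apply/measurable_EFinP; case/integrableP: ig.
have [||| | |ifg _] := @dominated_convergence _ _ _ mu I mI
  (fun n t => (f_ n t * g t)%:E) (fun t => (f t * g t)%:E)
  (fun t => (`|g t|)%:E).
- by move=> n; apply/measurable_EFinP; exact: (measurable_funM (mf_ n) mg).
- by apply/measurable_EFinP; exact: (measurable_funM mf mg).
- apply: (@filterS _ _ (ae_filter_ringOfSetsType mu)) ff => t ft It.
  apply/cvg_EFin; first by near=> n.
  by apply: cvgMr_tmp; exact: ft.
- exact: integrable_norm.
- apply: aeW => t n It; rewrite /= lee_fin normrM.
  by rewrite ler_piMl// fb.
move=> cv; apply: fine_cvg; rewrite fineK//.
exact: integrable_fin_num.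
Unshelve. all: by end_near. Qed.

Lemma ae_off_null (N : set R) (P : R -> Prop) :
  measurable N -> mu N = 0%E -> (forall t, ~ N t -> P t) ->
  {ae mu, forall t, P t}.
Proof.
move=> mN N0 NP; exists N; split => // t /= h.
by apply: contrapT => /NP.
Qed.

(** * Polynomials converging to indicators of balls *)

Lemma bernoulli_ineq (z : R) n : -1 <= z -> 1 + n%:R * z <= (1 + z) ^+ n.
Proof.
move=> z1; elim: n => [|n IH]; first by rewrite mul0r addr0 expr0.
rewrite exprS; apply: (@le_trans _ _ ((1 + z) * (1 + n%:R * z))).
  rewrite -natr1; have : 0 <= n%:R * z ^+ 2 by rewrite mulr_ge0// sqr_ge0.
  by lra.
by apply: ler_wpM2l IH; lra.
Qed.

(** Bernoulli at [- u ^+ n] bounds the sequence below by [1 - (K u)^n], which tends to 1. *)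
Lemma step_cvg1 (K : nat) (u : R) : 0 <= u -> (0 < K)%N -> K%:R * u < 1 ->
  (1 - u ^+ n) ^+ (K ^ n) @[n --> \oo] --> (1 : R).
Proof.
move=> u0 K0 Ku.
have u1 : u <= 1.
  by apply: le_trans (ltW Ku); rewrite ler_peMl// ler1n.
have un n : 0 <= u ^+ n <= 1 by rewrite exprn_ge0//= exprn_ile1.
apply: (@squeeze_cvgr _ _ _ _ (fun n => 1 - (K%:R * u) ^+ n) (fun=> 1)).
- apply: nearW => n; apply/andP; split; last first.
    by have := un n => /andP[? ?]; apply: exprn_ile1; lra.
  have := @bernoulli_ineq (- u ^+ n) (K ^ n)%N; have /andP[_ h] := un n.
  by rewrite lerN2 => /(_ h); rewrite exprMn natrX mulrN.
- rewrite -[X in _ --> X](subr0 1); apply: cvgB; first exact: cvg_cst.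
  by apply: cvg_expr; rewrite ger0_norm// mulr_ge0.
- exact: cvg_cst.
Qed.

(** With [v = u ^+ n] and [N = K ^ n], one has [(1 - v)^N (1 + v)^N <= 1], while Bernoulli gives
    [(1 + v)^N >= N v = (K u)^n]: the decay is geometric. *)
Lemma step_cvg0 (K : nat) (u : R) : 0 <= u <= 1 -> 1 < K%:R * u ->
  (1 - u ^+ n) ^+ (K ^ n) @[n --> \oo] --> (0 : R).
Proof.
move=> /andP[u0 u1] Ku.
have un n : 0 <= u ^+ n <= 1 by rewrite exprn_ge0//= exprn_ile1.
apply: (@squeeze_cvgr _ _ _ _ (fun=> 0) (fun n => (K%:R * u)^-1 ^+ n)).
- apply: nearW => n; have /andP[v0 v1] := un n; apply/andP; split.
    by rewrite exprn_ge0// subr_ge0.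
  rewrite exprVn -[leRHS]mul1r ler_pdivlMr; last by rewrite exprn_gt0//; lra.
  apply: (@le_trans _ _ ((1 - u ^+ n) ^+ (K ^ n) * (1 + u ^+ n) ^+ (K ^ n))).
    apply: ler_wpM2l; first by rewrite exprn_ge0// subr_ge0.
    have := @bernoulli_ineq (u ^+ n) (K ^ n)%N.
    have h : -1 <= u ^+ n by lra.
    by move=> /(_ h); rewrite exprMn -natrX; apply: le_trans; rewrite lerDr.
  rewrite -exprMn; apply: exprn_ile1.
    by rewrite mulr_ge0//; lra.
  have -> : (1 - u ^+ n) * (1 + u ^+ n) = 1 - (u ^+ n) ^+ 2 by ring.
  by rewrite gerBl sqr_ge0.
- exact: cvg_cst.
- apply: cvg_expr; rewrite ger0_norm ?invr_ge0; last lra.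
  by rewrite invf_lt1; lra.
Qed.

(** For [c] and [t] in [[-1, 1]], [u = (t - c)^2 / 4] lies in [[0, 1]]; the threshold [u = 1/K] of
    the two limits above is [|t - c| = 2 / sqrt K]. *)
Definition bump_poly (c : R) (K n : nat) : {poly R} :=
  (1 - (4^-1 *: ('X - c%:P) ^+ 2) ^+ n) ^+ (K ^ n).

Lemma bump_polyE c K n t :
  (bump_poly c K n).[t] = (1 - ((t - c) ^+ 2 / 4) ^+ n) ^+ (K ^ n).
Proof. by rewrite /bump_poly !(hornerE, horner_exp) /= -mulrA -expr2 mulrC. Qed.

Lemma sqr_dist_le4 c t : I c -> I t -> 0 <= (t - c) ^+ 2 / 4 <= 1.
Proof.
rewrite /I11 /= !in_itv /= => /andP[c1 c2] /andP[t1 t2].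
by rewrite divr_ge0 ?sqr_ge0//= ler_pdivrMr// mul1r; nra.
Qed.

Lemma bump_le1 c K n t : I c -> I t -> `|(bump_poly c K n).[t] ^+ 2| <= 1.
Proof.
move=> Ic It; rewrite normrX; apply: exprn_ile1 => //; rewrite bump_polyE normrX.
have /andP[u0 u1] := sqr_dist_le4 Ic It.
apply: exprn_ile1 => //; rewrite ler_norml.
have : 0 <= ((t - c) ^+ 2 / 4) ^+ n <= 1 by rewrite exprn_ge0//= exprn_ile1.
by lra.
Qed.

Definition bump_radius (K : nat) : R := 2 / Num.sqrt K%:R.

Lemma bump_radius_gt0 K : (0 < K)%N -> 0 < bump_radius K.
Proof. by move=> K0; rewrite divr_gt0// sqrtr_gt0 ltr0n. Qed.

Lemma sqr_bump_radius K : bump_radius K ^+ 2 = 4 / K%:R.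
Proof. by rewrite expr_div_n sqr_sqrtr// -natrX. Qed.

Lemma bump_cvg_in c K t : (0 < K)%N -> `|t - c| < bump_radius K ->
  (bump_poly c K n).[t] @[n --> \oo] --> (1 : R).
Proof.
move=> K0 tc; under eq_fun do rewrite bump_polyE.
apply: step_cvg1 => //; first by rewrite divr_ge0// sqr_ge0.
have : `|t - c| ^+ 2 < bump_radius K ^+ 2 by rewrite ltrXn2r.
rewrite real_normK ?num_real// sqr_bump_radius ltr_pdivlMr ?ltr0n//; lra.
Qed.

Lemma bump_cvg_out c K t :
  (0 < K)%N -> I c -> I t -> bump_radius K < `|t - c| ->
  (bump_poly c K n).[t] @[n --> \oo] --> (0 : R).
Proof.
move=> K0 Ic It tc; under eq_fun do rewrite bump_polyE.
apply: step_cvg0; first exact: sqr_dist_le4.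
have : bump_radius K ^+ 2 < `|t - c| ^+ 2.
  by rewrite ltrXn2r// ltW// bump_radius_gt0.
rewrite real_normK ?num_real// sqr_bump_radius ltr_pdivrMr ?ltr0n//; lra.
Qed.

(** * Positivity of the density and of the atom *)

Section PositiveOnSquares.
Variables (g : R -> R) (k : R).
Hypothesis ig : mu.-integrable I (EFin \o g).
Hypothesis hsqr : forall q,
  0 <= \int[mu]_(t in I) ((q ^+ 2).[t] * g t) + (q ^+ 2).[0] * k.

Lemma atom_ge0 : 0 <= k.
Proof.
(* [(q n)^2] is 1 at the atom and tends to 0 at every other point of [[-1, 1]], so only [k] survives
   in the limit. *)
pose q n : {poly R} := (1 - 'X ^+ 2) ^+ n.
have qE n t : (q n ^+ 2).[t] = ((1 - t ^+ 2) ^+ 2) ^+ n.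
  by rewrite /q !hornerE exprAC.
have I1 t : I t -> t ^+ 2 <= 1.
  by rewrite /I11 /= in_itv /= => /andP[t1 t2]; nra.
have I0 t : I t -> 0 <= (1 - t ^+ 2) ^+ 2 <= 1.
  move=> /I1 t1; rewrite sqr_ge0/=; apply: exprn_ile1; first lra.
  by rewrite gerBl sqr_ge0.
have qcv : \int[mu]_(t in I) ((q n ^+ 2).[t] * g t) @[n --> \oo]
    --> \int[mu]_(t in I) (0 * g t).
  apply: Rintegral_cvg_bounded => //.
  - by move=> n; exact: measurable_poly.
  - move=> n t It; have /andP[? ?] := I0 _ It; rewrite qE ger0_norm.
      exact: exprn_ile1.
    exact: exprn_ge0.
  - apply: (@ae_off_null [set 0]) => //; first exact: lebesgue_measure_set1.
    move=> t t0 It.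
    under eq_fun do rewrite qE.
    apply: cvg_expr; have /andP[a0 a1] := I0 _ It; rewrite ger0_norm//.
    have : 0 < t ^+ 2 by rewrite exprn_even_gt0//=; apply/eqP.
    by have := I1 _ It; nra.
have -> : k = \int[mu]_(t in I) (0 * g t) + k.
  rewrite (@eq_Rintegral _ _ _ mu I (fun=> 0)) ?Rintegral_cst//=.
  - by rewrite mul0r add0r.
  - exact: measurable_I11.
  - by move=> t _; rewrite mul0r.
apply: (cvgr_to_ge (cvgD qcv (cvg_cst k))).
apply: nearW => n; have := hsqr (q n).
by rewrite [X in _ + X * k]qE expr0n subr0 !expr1n mul1r.
Qed.

(** The bound on [|c|] keeps 0 outside the closed ball, so the term in [k] dies in the limit and
    only the density is tested. *)
Lemma integral_ball_ge0 c K : I c -> (0 < K)%N -> bump_radius K < `|c| ->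
  0 <= \int[mu]_(t in I) (\1_(ball c (bump_radius K)) t * g t).
Proof.
move=> Ic K0 Kc; set f := \1_ _.
have qcv : \int[mu]_(t in I) ((bump_poly c K n ^+ 2).[t] * g t) @[n --> \oo]
    --> \int[mu]_(t in I) (f t * g t).
  apply: Rintegral_cvg_bounded => //.
  - by move=> n; exact: measurable_poly.
  - exact: (measurable_indic (measurable_ball _ _)).
  - by move=> n t It; rewrite horner_exp; exact: bump_le1.
  (* The end points of the ball, where the limit may differ from the indicator, form a null set. *)
  - apply: (@ae_off_null [set c - bump_radius K; c + bump_radius K]).
    + exact: measurableU.
    + apply: countable_lebesgue_measure0.
      exact/finite_set_countable.
    + move=> t tn It.
      under eq_fun do rewrite horner_exp expr2.
      have [tc|tc|tc] := ltgtP (`|t - c|) (bump_radius K).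
      * rewrite /f indicE mem_set /=; last by rewrite /ball /= distrC.
        have -> : true%:R = 1 * 1 :> R by rewrite mulr1.
        by apply: cvgM; exact: bump_cvg_in.
      * rewrite /f indicE memNset /=; last first.
          by rewrite /ball /= distrC ltNge (ltW tc).
        have -> : false%:R = 0 * 0 :> R by rewrite mulr0.
        by apply: cvgM; exact: bump_cvg_out.
      * exfalso; apply: tn; move: tc; case: ler0P => _ <-; [left|right]; ring.
have qcv0 : (bump_poly c K n ^+ 2).[0] * k @[n --> \oo] --> (0 : R).
  have I0 : I 0 by rewrite /I11 /= in_itv /= lerN10 ler01.
  have h0 : (bump_poly c K n).[0] @[n --> \oo] --> (0 : R).
    by apply: bump_cvg_out => //; rewrite sub0r normrN.
  have : (bump_poly c K n).[0] * (bump_poly c K n).[0] * k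
      @[n --> \oo] --> 0 * 0 * k.
    by apply: cvgM; [apply: cvgM|exact: cvg_cst].
  rewrite !mul0r.
  suff -> : (fun n => (bump_poly c K n ^+ 2).[0] * k) =
    (fun n => (bump_poly c K n).[0] * (bump_poly c K n).[0] * k) by [].
  by apply/funext => n; rewrite horner_exp expr2.
rewrite -[leRHS]addr0.
apply: (cvgr_to_ge (cvgD qcv qcv0)).
by apply: nearW => n; exact: hsqr.
Qed.

Lemma bump_radius_cvg0 : bump_radius n.+1 @[n --> \oo] --> 0.
Proof.
apply/cvgr0Pnorm_lt => e e0.
near=> n.
rewrite gtr0_norm ?bump_radius_gt0//.
rewrite -(@ltr_pXn2r _ 2)// ?nnegrE ?ltW// ?bump_radius_gt0// sqr_bump_radius.
rewrite ltr_pdivrMr ?ltr0n// mulrC -ltr_pdivrMr ?exprn_gt0//.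
apply: (@lt_trans _ _ n%:R); last by rewrite ltr_nat.
near: n; exact: nbhs_infty_gtr.
Unshelve. all: by end_near. Qed.

(** At a Lebesgue point [x <> 0] of [[-1, 1]], [g x] is the limit of averages over shrinking balls,
    which are nonnegative once the radius is below [|x|]. *)
Lemma density_ge0 : {ae mu, forall t, I t -> 0 <= g t}.
Proof.
(* The shift to [n.+1] avoids [K = 0], where division by zero makes the radius 0. *)
pose E (x : R) n := ball x (bump_radius n.+1).
have nice x : nicely_shrinking x (E x).
  split=> [n|]; first exact: measurable_ball.
  exists (1, fun n => PosNum (@bump_radius_gt0 n.+1 isT)); split => //=.
  - exact: bump_radius_cvg0.
  - by move=> n t; rewrite /E.
  - by move=> n; rewrite mul1e.
have igI : mu.-integrable setT (EFin \o (g \_ I)).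
  by rewrite -restrict_EFin; apply/integrable_restrict => //; rewrite ?setTI; 
     [exact: measurable_I11|].
have locg : locally_integrable setT (g \_ I).
  by apply: open_integrable_locally => //; exact: openT.
have := lebesgue_differentiation locg.
have ae0 : {ae mu, forall t : R, t <> 0}.
  apply: (@ae_off_null [set 0]) => //; exact: lebesgue_measure_set1.
move=> h; have := @filterI _ _ (ae_filter_ringOfSetsType mu) _ _ h ae0.
apply: (@filterS _ _ (ae_filter_ringOfSetsType mu)) => x [xL x0] Ix.
have := nice_lebesgue_differentiation nice locg xL.
rewrite patchE mem_set// => cv.
rewrite -lee_fin; apply: (closed_cvg (fun y : \bar R => (0 <= y)%E) _ _ _ cv).
  exact: closed_ereal_le_ereal.
have xr : 0 < `|x| by rewrite normr_gt0; apply/eqP.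
near=> n.
apply: mule_ge0; first by rewrite inve_ge0.
have ri : bump_radius n.+1 < `|x|.
  apply: le_lt_trans (ler_norm _) _; near: n.
  by have /cvgr0Pnorm_lt := bump_radius_cvg0; apply.
have := integral_ball_ge0 Ix (ltn0Sn n) ri.
have fin := @integrable_fin_num _ _ _ mu _ (@measurable_I11) _
  (integrable_indic_mul (measurable_ball x (bump_radius n.+1)) ig).
rewrite -lee_fin /Rintegral fineK// => /le_trans; apply.
rewrite le_eqVlt; apply/orP; left; apply/eqP.
rewrite integral_mkcond [RHS]integral_mkcond; apply: eq_integral => t _.
rewrite !patchE /E indicE; case: (t \in I);
  case: (t \in (ball x (bump_radius n.+1) : set R)) => //=;
  by rewrite ?mul1r ?mul0r.
Unshelve. all: by end_near. Qed.

Lemma integral_indic_ge0 (A : set R) : measurable A ->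
  0 <= \int[mu]_(t in I) (\1_A t * g t) + \1_A 0 * k.
Proof.
move=> mA; apply: addr_ge0; last first.
  by rewrite mulr_ge0// atom_ge0.
have ifg := integrable_indic_mul mA ig.
have mfg := measurable_int _ ifg.
(* As [g] is nonnegative only almost everywhere, the integrand is traded for its absolute value. *)
rewrite /Rintegral (@ae_eq_integral _ _ _ mu I (fun t => `|\1_A t * g t|%:E)) //.
- by apply: fine_ge0; apply: integral_ge0 => t _; rewrite lee_fin.
- exact: measurable_I11.
- by case/integrableP: (integrable_norm ifg).
- apply: (@filterS _ _ (ae_filter_ringOfSetsType mu)) density_ge0 => t g0 It.
  by rewrite ger0_norm// mulr_ge0// g0.
Qed.

End PositiveOnSquares.
End Analysis.

(** * Tridiagonal matrices and potential coefficients *)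

Lemma int_bi_ind (P : int -> Prop) : P 0 -> (forall n, P n -> P (n + 1)) ->
  (forall n, P n -> P (n - 1)) -> forall n, P n.
Proof.
move=> P0 PS PP; elim/int_rec => [//|n /PS|n /PP].
  by rewrite -PoszD addn1.
by rewrite -opprD -PoszD addn1.
Qed.

Section Walks.
Variable R : realType.
Implicit Types (a b c x y s r : int -> R) (P : int -> int -> R).

Lemma tridiagE a b c n : [/\ tridiag a b c n (n + 1) = a n,
  tridiag a b c n n = b n & tridiag a b c n (n - 1) = c n].
Proof.
rewrite /tridiag !eqxx.
have -> : (n == n + 1) = false by apply/eqP; lia.
have -> : (n - 1 == n + 1) = false by apply/eqP; lia.
by have -> : (n - 1 == n) = false by apply/eqP; lia.
Qed.

Lemma tridiag_out a b c i k :
  k \notin [:: i + 1; i; i - 1] -> tridiag a b c i k = 0.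
Proof.
by rewrite /tridiag !inE !negb_or => /and3P[/negPf -> /negPf -> /negPf ->].
Qed.

Lemma mulZ_tridiag a b c P i j : mulZ (tridiag a b c) P i j =
  a i * P (i + 1) j + b i * P i j + c i * P (i - 1) j.
Proof.
rewrite /mulZ -(@fsbig_widen _ _ _ _ [set` [:: i + 1; i; i - 1]]) //; last first.
  move=> k [_ /= /negP]; rewrite -?notin_setE => kn.
  by rewrite tridiag_out ?mul0r.
rewrite -fsbig_seq; last by rewrite /= !inE !andbT; lia.
rewrite !big_cons big_nil; have [-> -> ->] := tridiagE a b c i.
by rewrite /= addr0 addrA.
Qed.

(** The formula for negative integers is also right at 0, both products being empty, so passing from
    -1 to 0 needs no separate case. *)
Lemma potentialN P (m : nat) : potential P (- m%:Z) =
  (\prod_(0 <= k < m) P (- k%:Z) (- k%:Z - 1)) /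
  (\prod_(1 <= k < m.+1) P (- k%:Z) (- k%:Z + 1)).
Proof. by case: m => [|m] //; rewrite /= !big_geq. Qed.

(** Detailed balance [pi_(n+1) c_(n+1) = pi_n a_n] on all of Z: one factor splits off each
    product. *)
Lemma potentialS P (n : int) :
  (forall n, P n (n + 1) != 0) -> (forall n, P n (n - 1) != 0) ->
  potential P (n + 1) * P (n + 1) n = potential P n * P n (n + 1).
Proof.
move=> P1 P2.
have prod1 m : \prod_(1 <= k < m) P k%:Z (k%:Z - 1) != 0.
  by rewrite prodf_seq_neq0; apply/allP => k _; rewrite P2.
have prodN1 m : \prod_(1 <= k < m) P (- k%:Z) (- k%:Z + 1) != 0.
  by rewrite prodf_seq_neq0; apply/allP => k _; rewrite P1.
case: n => m.
- rewrite -PoszD addn1 /=.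
  rewrite (@big_nat_recr _ _ _ m 0)// (@big_nat_recr _ _ _ m.+1 1)//=.
  have -> : m.+1%:Z - 1 = m%:Z by lia.
  have -> : m%:Z + 1 = m.+1%:Z by lia.
  have := P2 m.+1; have := prod1 m.+1.
  have -> : m.+1%:Z - 1 = m%:Z by lia.
  by move=> h1 h2; field; rewrite h1 h2.
- rewrite NegzE; have -> : - m.+1%:Z + 1 = - m%:Z by lia.
  rewrite !potentialN.
  rewrite (@big_nat_recr _ _ _ m 0)// (@big_nat_recr _ _ _ m.+1 1)//=.
  have -> : - m.+1%:Z + 1 = - m%:Z by lia.
  have -> : - m%:Z - 1 = - m.+1%:Z by lia.
  have := P1 (- m.+1%:Z); have := prodN1 m.+1.
  have -> : - m.+1%:Z + 1 = - m%:Z by lia.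
  by move=> h1 h2; field; rewrite h1 h2.
Qed.

Lemma potential_gt0 P (n : int) :
  (forall n, 0 < P n (n + 1)) -> (forall n, 0 < P n (n - 1)) ->
  0 < potential P n.
Proof.
move=> P1 P2.
have P1' m : 0 < P (m - 1) m by have := P1 (m - 1); rewrite subrK.
have P2' m : 0 < P (m + 1) m by have := P2 (m + 1); rewrite addrK.
have pS m : potential P (m + 1) * P (m + 1) m = potential P m * P m (m + 1).
  by apply: potentialS => k; rewrite gt_eqF.
elim/int_bi_ind: n => [|n IH|n IH].
- by rewrite /= big_geq// big_geq// divr1.
- by rewrite -(pmulr_lgt0 _ (P2' n)) pS mulr_gt0.
- rewrite -(pmulr_lgt0 _ (P1' n)); have := pS (n - 1); rewrite subrK => <-.
  exact: mulr_gt0.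
Qed.

Lemma three_term_unique a b c (U V : int -> {poly R}) :
  (forall n, a n != 0) -> (forall n, c n != 0) ->
  (forall n, 'X * U n = a n *: U (n + 1) + b n *: U n + c n *: U (n - 1)) ->
  (forall n, 'X * V n = a n *: V (n + 1) + b n *: V n + c n *: V (n - 1)) ->
  U 0 = V 0 -> U (-1) = V (-1) -> forall n, U n = V n.
Proof.
move=> a0 c0 HU HV UV0 UV1 n.
(* The recurrence has order two, so the induction carries two consecutive values; nonzero outer
   coefficients allow a step either way. *)
suff [] : U n = V n /\ U (n - 1) = V (n - 1) by [].
elim/int_bi_ind: n => [|n [h1 h2]|n [h1 h2]]; first by rewrite sub0r.
- rewrite addrK; split => //; apply: (scalerI (a0 n)).
  have := HU n; rewrite h1 h2 HV => /eqP.
  by rewrite (inj_eq (addIr _)) (inj_eq (addIr _)) => /eqP.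
- split => //; apply: (scalerI (c0 (n - 1))).
  have := HU (n - 1); rewrite h2 HV subrK h1 => /eqP.
  by rewrite (inj_eq (addrI _)) => /eqP.
Qed.

Lemma ord2_cases (i : 'I_2) : i = 0 \/ i = 1.
Proof. by case: i => [[|[|//]] i]; [left|right]; apply/val_inj. Qed.

Lemma big_ord2 (V : nmodType) (F : 'I_2 -> V) : \sum_i F i = F 0 + F 1.
Proof.
by rewrite !big_ord_recl big_ord0 addr0; congr (_ + F _); apply/val_inj.
Qed.

(** * Bilinear forms on rows of polynomials *)

Definition polylin (L : 'I_2 -> 'I_2 -> {poly R} -> R) :=
  forall i j (k : R) p q, L i j (k *: p + q) = k * L i j p + L i j q.

(** With [L] given by a matrix measure, this sums the integrals of [u_i v_j] against its entries.
    Keeping [L] abstract makes the Gram computations purely algebraic. *)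
Definition pairing (L : 'I_2 -> 'I_2 -> {poly R} -> R)
    (u v : 'I_2 -> {poly R}) :=
  \sum_i \sum_j L i j (u i * v j).

Section Pairing.
Variable L : 'I_2 -> 'I_2 -> {poly R} -> R.
Hypothesis linL : polylin L.

Lemma polylin0 i j : L i j 0 = 0.
Proof.
have := linL i j 1 0 0; rewrite scaler0 addr0 mul1r => /eqP.
by rewrite -subr_eq0 opprD addrA subrr add0r oppr_eq0 => /eqP.
Qed.

Lemma polylinZ i j (c : R) p : L i j (c *: p) = c * L i j p.
Proof. by rewrite -[c *: p]addr0 linL polylin0 addr0. Qed.

Lemma polylinD i j p q : L i j (p + q) = L i j p + L i j q.
Proof. by have := linL i j 1 p q; rewrite scale1r mul1r. Qed.

Lemma polylin_sum i j (T : Type) (l : seq T) (F : T -> {poly R}) :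
  L i j (\sum_(k <- l) F k) = \sum_(k <- l) L i j (F k).
Proof. 
by elim: l => [|k l IH]; rewrite ?big_nil ?polylin0// !big_cons polylinD IH.
Qed.

Lemma pairing_linl (c : R) u u' v :
  pairing L (fun i => c *: u i + u' i) v = c * pairing L u v + pairing L u' v.
Proof.
rewrite /pairing mulr_sumr -big_split; apply: eq_bigr => i _.
rewrite mulr_sumr -big_split; apply: eq_bigr => j _ /=.
by rewrite mulrDl -scalerAl linL.
Qed.

Lemma pairing_linr (c : R) u v v' :
  pairing L u (fun i => c *: v i + v' i) = c * pairing L u v + pairing L u v'.
Proof.
rewrite /pairing mulr_sumr -big_split; apply: eq_bigr => i _.
rewrite mulr_sumr -big_split; apply: eq_bigr => j _ /=.
by rewrite mulrDr -scalerAr linL.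
Qed.

Lemma pairing_addl u u' v :
  pairing L (fun i => u i + u' i) v = pairing L u v + pairing L u' v.
Proof.
rewrite /pairing -big_split; apply: eq_bigr => i _; rewrite -big_split.
by apply: eq_bigr => j _; rewrite mulrDl polylinD.
Qed.

Lemma pairing_scalel (c : R) u v :
  pairing L (fun i => c *: u i) v = c * pairing L u v.
Proof.
rewrite /pairing mulr_sumr; apply: eq_bigr => i _; rewrite mulr_sumr.
by apply: eq_bigr => j _; rewrite -scalerAl polylinZ.
Qed.

Lemma pairing_scaler (c : R) u v :
  pairing L u (fun i => c *: v i) = c * pairing L u v.
Proof.
rewrite /pairing mulr_sumr; apply: eq_bigr => i _; rewrite mulr_sumr.
by apply: eq_bigr => j _; rewrite -scalerAr polylinZ.
Qed.

Lemma pairing0l v : pairing L (fun=> 0) v = 0.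
Proof. by rewrite /pairing; do 2![apply: big1 => ? _]; rewrite mul0r polylin0. Qed.

Lemma pairing0r u : pairing L u (fun=> 0) = 0.
Proof. by rewrite /pairing; do 2![apply: big1 => ? _]; rewrite mulr0 polylin0. Qed.

Lemma pairing_suml (T : Type) (l : seq T) (c : T -> R) u v :
  pairing L (fun i => \sum_(k <- l) c k *: u k i) v =
  \sum_(k <- l) c k * pairing L (u k) v.
Proof.
elim: l => [|k l IH].
  by rewrite big_nil -[RHS](pairing0l v); congr pairing;
    apply/funext => i; rewrite big_nil.
rewrite big_cons -IH -pairing_linl; congr pairing.
by apply/funext => i; rewrite big_cons.
Qed.

Lemma pairing_sumr (T : Type) (l : seq T) (c : T -> R) u v :
  pairing L u (fun i => \sum_(k <- l) c k *: v k i) =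
  \sum_(k <- l) c k * pairing L u (v k).
Proof.
elim: l => [|k l IH].
  by rewrite big_nil -[RHS](pairing0r u); congr pairing;
    apply/funext => i; rewrite big_nil.
rewrite big_cons -IH -pairing_linr; congr pairing.
by apply/funext => i; rewrite big_cons.
Qed.

(** Moves the factors of a congruent matrix measure onto the rows; it relates orthogonality for the
    new spectral matrix to orthogonality for [PsiS]. *)
Lemma pairing_mul (A B : 'I_2 -> 'I_2 -> {poly R}) u v :
  pairing (fun i j p => \sum_k \sum_l L k l (A i k * p * B j l)) u v =
  pairing L (fun k => \sum_i u i * A i k) (fun l => \sum_j v j * B j l).
Proof.
rewrite /pairing.
under eq_bigr => i _ do rewrite exchange_big/=.
rewrite exchange_big/=; apply: eq_bigr => k _.
under eq_bigr => i _ do rewrite exchange_big/=.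
rewrite exchange_big/=; apply: eq_bigr => l _.
rewrite big_distrlr/= polylin_sum; apply: eq_bigr => i _.
rewrite polylin_sum; apply: eq_bigr => j _; congr (L _ _ _); ring.
Qed.

End Pairing.
End Walks.

(** * The Darboux transformation *)

Section Darboux.
Variable R : realType.
Variables (x y s r : int -> R).
Hypothesis x0 : forall n, x n != 0.
Hypothesis y0 : forall n, y n != 0.
Hypothesis s0 : forall n, s n != 0.
Hypothesis r0 : forall n, r n != 0.

Definition Spoly (Q : 'I_2 -> int -> {poly R}) (n : int) (i : 'I_2) :=
  s n *: Q i n + r n *: Q i (n - 1).

(** The rows are [S_0] and [S_(-1)], the latter solved from
    [X Q_(-1) = y_(-1) S_(-1) + x_(-1) S_0]. *)
Definition S0poly (i j : 'I_2) : {poly R} :=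
  if i == 0 then (if j == 0 then (s 0)%:P else (r 0)%:P)
  else if j == 0 then (- (x (-1) * s 0 / y (-1)))%:P
       else (y (-1))^-1 *: ('X - (x (-1) * r 0)%:P).

Lemma S0polyE t i j : S0 x y s r t i j = (S0poly i j).[t].
Proof.
rewrite /S0 /S0poly !mxE; case: (i == 0); case: (j == 0); rewrite !hornerE //.
by rewrite mulrC.
Qed.

Section Polys.
Variable Q : 'I_2 -> int -> {poly R}.
Hypothesis Q0 : Q 0 0 = 1 /\ Q 1 0 = 0.
Hypothesis Qm1 : Q 0 (-1) = 0 /\ Q 1 (-1) = 1.
Hypothesis recQ : forall i n,
  'X * Q i n = (x n * s (n + 1)) *: Q i (n + 1)
    + (x n * r (n + 1) + y n * s n) *: Q i n + (y n * r n) *: Q i (n - 1).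

(** This is [x Q = P_U (P_L Q)] with [S = P_L Q]. *)
Lemma mulX_Q i n :
  'X * Q i n = y n *: Spoly Q n i + x n *: Spoly Q (n + 1) i.
Proof.
by rewrite recQ /Spoly addrK -!mul_polyC !(polyCM, polyCD); ring.
Qed.

(** Applying [P_L] to [x Q = P_U S] gives [x S = P_L P_U S]. *)
Lemma mulX_S i n : 'X * Spoly Q n i = (s n * x n) *: Spoly Q (n + 1) i
  + (r n * x (n - 1) + s n * y n) *: Spoly Q n i
  + (r n * y (n - 1)) *: Spoly Q (n - 1) i.
Proof.
rewrite {1}/Spoly mulrDr -!scalerAr !mulX_Q subrK.
by rewrite -!mul_polyC !(polyCM, polyCD); ring.
Qed.

Lemma Spoly0 : Spoly Q 0 0 = (s 0)%:P /\ Spoly Q 0 1 = (r 0)%:P.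
Proof.
have [q1 q2] := Q0; have [q3 q4] := Qm1.
by rewrite /Spoly q1 q2 sub0r q3 q4 !scaler0 !alg_polyC addr0 add0r.
Qed.

Variable Qt : 'I_2 -> int -> {poly R}.
Hypothesis Qt0 : Qt 0 0 = 1 /\ Qt 1 0 = 0.
Hypothesis Qtm1 : Qt 0 (-1) = 0 /\ Qt 1 (-1) = 1.
Hypothesis recQt : forall i n,
  'X * Qt i n = (s n * x n) *: Qt i (n + 1)
    + (r n * x (n - 1) + s n * y n) *: Qt i n
    + (r n * y (n - 1)) *: Qt i (n - 1).

Lemma Qt_mul_S0 n i : \sum_k Qt k n * S0poly k i = Spoly Q n i.
Proof.
apply: (@three_term_unique _ (fun n => s n * x n)
  (fun n => r n * x (n - 1) + s n * y n) (fun n => r n * y (n - 1))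
  (fun n => \sum_k Qt k n * S0poly k i) (fun n => Spoly Q n i)).
- by move=> m; rewrite mulf_neq0.
- by move=> m; rewrite mulf_neq0.
- move=> m; rewrite !scaler_sumr mulr_sumr -!big_split/=; apply: eq_bigr => k _.
  by rewrite mulrA recQt !mulrDl !scalerAl.
- exact: mulX_S.
- have [q1 q2] := Qt0; have [S1 S2] := Spoly0.
  rewrite big_ord2 q1 q2 mul0r addr0 mul1r.
  by have [->|->] := ord2_cases i; rewrite ?S1 ?S2.
- have [q1 q2] := Qm1; have [q3 q4] := Qtm1; have [S1 S2] := Spoly0.
  rewrite big_ord2 q3 q4 mul0r add0r mul1r.
  (* By definition [S_(-1)] involves [Q_(-2)]; [mulX_Q] at -1 expresses it through the initial data
     instead. *)
  apply: (scalerI (y0 (-1))).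
  have -> : y (-1) *: Spoly Q (-1) i = 'X * Q i (-1) - x (-1) *: Spoly Q 0 i.
    by rewrite mulX_Q addNr addrK.
  have [->|->] := ord2_cases i; rewrite /S0poly /= ?S1 ?S2 ?q1 ?q2.
    rewrite mulr0 sub0r -!mul_polyC -!polyCM -polyCN; congr polyC; field.
    exact: y0.
  by rewrite scalerA divff// scale1r mulr1 -mul_polyC -polyCM.
Qed.

End Polys.

(** * The Gram matrix of the rows [S_n] *)

Section Gram.
Variables (p pt : int -> R).
Hypothesis p0 : p 0 = 1.
Hypothesis pt0 : pt 0 = 1.
Hypothesis p_neq0 : forall n, p n != 0.
Hypothesis pt_neq0 : forall n, pt n != 0.
Hypothesis pS : forall n, p (n + 1) * (y (n + 1) * r (n + 1)) =
  p n * (x n * s (n + 1)).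
Hypothesis ptS : forall n, pt (n + 1) * (r (n + 1) * y n) = pt n * (s n * x n).

(** By detailed balance for both walks, the two sides are multiplied by the same ratio from [n] to
    [n + 1], and they agree at 0. *)
Lemma potential_darboux n : y n * s 0 * p n = y 0 * s n * pt n.
Proof.
have key m : y (m + 1) * s 0 * p (m + 1) * (s m * r (m + 1)) =
    y m * s 0 * p m * (x m * s m * s (m + 1) / y m).
  transitivity (s 0 * s m * (p (m + 1) * (y (m + 1) * r (m + 1)))); first ring.
  by rewrite pS; field.
have keyt m : y 0 * s (m + 1) * pt (m + 1) * (s m * r (m + 1)) =
    y 0 * s m * pt m * (x m * s m * s (m + 1) / y m).
  transitivity (y 0 * s (m + 1) * s m / y m * (pt (m + 1) * (r (m + 1) * y m))).
    by field.
  by rewrite ptS; field.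
elim/int_bi_ind: n => [|n IH|n IH].
- by rewrite p0 pt0; ring.
- have h : s n * r (n + 1) != 0 by rewrite mulf_neq0.
  by apply: (mulIf h); rewrite key keyt IH.
- have h : x (n - 1) * s (n - 1) * s n / y (n - 1) != 0.
    by rewrite !mulf_neq0// invr_neq0.
  apply: (mulIf h); have := key (n - 1); have := keyt (n - 1).
  by rewrite subrK => <- <-; rewrite IH.
Qed.

Lemma first_order_zero (D : int -> R) :
  (forall n, y n * D n + x n * D (n + 1) = 0) -> D 0 = 0 -> forall n, D n = 0.
Proof.
move=> rec D0; elim/int_bi_ind => [//|n IH|n IH].
- have := rec n; rewrite IH mulr0 add0r => /eqP.
  by rewrite mulf_eq0 (negPf (x0 _)) => /eqP.
- have := rec (n - 1); rewrite subrK IH mulr0 addr0 => /eqP.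
  by rewrite mulf_eq0 (negPf (y0 _)) => /eqP.
Qed.

Variable Q : 'I_2 -> int -> {poly R}.
Hypothesis Q0 : Q 0 0 = 1 /\ Q 1 0 = 0.
Hypothesis Qm1 : Q 0 (-1) = 0 /\ Q 1 (-1) = 1.
Hypothesis recQ : forall i n,
  'X * Q i n = (x n * s (n + 1)) *: Q i (n + 1)
    + (x n * r (n + 1) + y n * s n) *: Q i n + (y n * r n) *: Q i (n - 1).
Variables (L LS : 'I_2 -> 'I_2 -> {poly R} -> R).
Hypothesis linL : polylin L.
Hypothesis linLS : polylin LS.
Hypothesis LS_sym : forall i j q, LS i j q = LS j i q.
Hypothesis LSX : forall i j q, LS i j ('X * q) = y 0 / s 0 * L i j q.
Hypothesis LS1 : forall i j, LS i j 1 = mx2 (1 / s 0) 0 0 (1 / r 0) i j.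
Hypothesis sr1 : s 0 + r 0 = 1.
Hypothesis orthQ : forall n m,
  pairing L (Q^~ n) (Q^~ m) = (n == m)%:R / p m.

Lemma pairing_sym u v : pairing LS u v = pairing LS v u.
Proof.
rewrite /pairing exchange_big/=; apply: eq_bigr => i _; apply: eq_bigr => j _.
by rewrite LS_sym mulrC.
Qed.

(** [S_0] is the constant row [(s_0, r_0)], so the weights [1/s_0] and [1/r_0] give [s_0 + r_0]. *)
Lemma gram00 : pairing LS (Spoly Q 0) (Spoly Q 0) = 1.
Proof.
have [S1 S2] := Spoly0 Q0 Qm1.
rewrite /pairing !big_ord2.
rewrite S1 S2 -!polyCM.
have C i j c : LS i j c%:P = c * LS i j 1 by rewrite -alg_polyC polylinZ.
rewrite (C 0 0) (C 0 1) (C 1 0) (C 1 1) !LS1 !mxE /= !mulr0 addr0 add0r.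
transitivity (s 0 + r 0) => //; field.
by rewrite s0 r0.
Qed.

(** The left side pairs [X Q_n] with [S_m]. The factor [X] turns [LS] into a multiple of [L], for
    which [S_m = s_m Q_m + r_m Q_(m-1)] meets [Q_n] only when [m] is [n] or [n + 1]. *)
Lemma gram_rec n m :
  y n * pairing LS (Spoly Q n) (Spoly Q m) +
  x n * pairing LS (Spoly Q (n + 1)) (Spoly Q m) =
  y n * ((n == m)%:R / pt m) + x n * ((n + 1 == m)%:R / pt m).
Proof.
transitivity (y 0 / s 0 * pairing L (Q^~ n) (Spoly Q m)).
  transitivity (pairing LS (fun i => 'X * Q i n) (Spoly Q m)).
    rewrite -!(pairing_scalel linLS) -(pairing_addl linLS); congr pairing.
    by apply/funext => i; rewrite mulX_Q.
  rewrite /pairing mulr_sumr; apply: eq_bigr => i _; rewrite mulr_sumr.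
  by apply: eq_bigr => j _; rewrite -mulrA LSX.
rewrite /Spoly (pairing_linr linL) (pairing_scaler linL) !orthQ.
have [<-|nm] := eqVneq n m.
  have -> : (n == n - 1) = false by apply/eqP; lia.
  have -> : (n + 1 == n) = false by apply/eqP; lia.
  have := potential_darboux n; rewrite !mul1r !mul0r !mulr0 !addr0 => h.
  have : y n / pt n = y 0 / s 0 * (s n / p n).
    apply: (mulIf (s0 0)); apply: (mulIf (p_neq0 n)).
    apply: (mulIf (pt_neq0 n)).
    transitivity (y n * s 0 * p n); first by field.
    by rewrite h; field; rewrite s0 p_neq0.
  by [].
have [m1|nm1] := eqVneq (n + 1) m; last first.
  have -> : (n == m - 1) = false.
    by apply/negbTE; apply: contra nm1 => /eqP ->; rewrite subrK.
  by rewrite /= !mulr0n !mul0r !mulr0 !addr0 mulr0.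
rewrite -m1 addrK eqxx /= !mulr0n mulr1n !mul0r !mulr0 !add0r !mul1r.
(* For [m = n + 1] the claim is [y_0 r_(n+1) / (s_0 p_n) = x_n / pt_(n+1)]: [potential_darboux]
   combined with the detailed balance [ptS]. *)
have h := potential_darboux n.
have ysp : s 0 * p n * y n != 0 by rewrite !mulf_neq0.
apply: (mulIf (pt_neq0 (n + 1))); apply: (mulIf ysp).
transitivity (y 0 * (pt (n + 1) * (r (n + 1) * y n))).
  by field; rewrite s0 p_neq0.
rewrite ptS; transitivity (x n * (y n * s 0 * p n)); last by field.
by rewrite h; ring.
Qed.

Lemma gram n m :
  pairing LS (Spoly Q n) (Spoly Q m) = (n == m)%:R / pt m.
Proof.
(* [D] vanishes first for [m = 0], starting from [gram00]; by symmetry it vanishes at [n = 0] for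
   every [m], which starts the recurrence in [n]. *)
pose D n m := pairing LS (Spoly Q n) (Spoly Q m) - (n == m)%:R / pt m.
have Drec m' n' : y n' * D n' m' + x n' * D (n' + 1) m' = 0.
  by have := gram_rec n' m'; rewrite /D; lra.
have Dn0 n' : D n' 0 = 0.
  apply: (first_order_zero (Drec 0)).
  by rewrite /D gram00 eqxx pt0 divr1 subrr.
apply/eqP; rewrite -subr_eq0 -/(D n m); apply/eqP.
apply: (first_order_zero (Drec m)).
rewrite -(Dn0 m) /D pairing_sym eq_sym; congr (_ - _).
by have [->|_] := eqVneq m 0; rewrite /= ?mulr0n ?mul0r.
Qed.

End Gram.
End Darboux.

(** * Positivity on squares, from orthogonality *)

Section Squares.
Variable R : realType.
Variables (a b c pt : int -> R) (Q : 'I_2 -> int -> {poly R}).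
Hypothesis recQ : forall i n,
  'X * Q i n = a n *: Q i (n + 1) + b n *: Q i n + c n *: Q i (n - 1).
Hypothesis Q0 : Q 0 0 = 1 /\ Q 1 0 = 0.
Hypothesis Qm1 : Q 0 (-1) = 0 /\ Q 1 (-1) = 1.
Variable L : 'I_2 -> 'I_2 -> {poly R} -> R.
Hypothesis linL : polylin L.
Hypothesis orthQ : forall n m,
  pairing L (Q^~ n) (Q^~ m) = (n == m)%:R / pt m.
Hypothesis pt_gt0 : forall n, 0 < pt n.

(** Pairs are a coefficient and an index; repeated indices are allowed, so that adding combinations
    is concatenation. *)
Definition row_span (u : 'I_2 -> {poly R}) :=
  exists l : seq (R * int), u = fun i => \sum_(k <- l) k.1 *: Q i k.2.

Lemma row_span_lin (e : R) u v : row_span u -> row_span v ->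
  row_span (fun i => e *: u i + v i).
Proof.
move=> [l ->] [l' ->]; exists ([seq (e * k.1, k.2) | k <- l] ++ l').
apply/funext => i; rewrite big_cat big_map scaler_sumr/=; congr (_ + _).
by apply: eq_bigr => k _; rewrite scalerA.
Qed.

(** Induction on [q]: each factor [X] is absorbed by the three-term recurrence. *)
Lemma row_span_mul q n : row_span (fun i => q * Q i n).
Proof.
elim/poly_ind: q n => [|q e IH] n.
  by exists [::]; apply/funext => i; rewrite big_nil mul0r.
have s1 : row_span (fun i => Q i n).
  by exists [:: (1, n)]; apply/funext => i; rewrite big_seq1 scale1r.
have -> : (fun i => (q * 'X + e%:P) * Q i n) = (fun i =>
    a n *: (q * Q i (n + 1)) + (b n *: (q * Q i n) + (c n *: (q * Q i (n - 1)) +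
    (e *: Q i n + 0)))).
  apply/funext => i; rewrite addr0 mulrDl -mulrA recQ -!mul_polyC; ring.
do 4![apply: row_span_lin => //].
by exists [::]; apply/funext => i; rewrite big_nil.
Qed.

Lemma pairing_row_span_ge0 u : row_span u -> 0 <= pairing L u u.
Proof.
move=> [l ->]; rewrite pairing_suml//.
under eq_bigr => k _ do rewrite pairing_sumr// mulr_sumr.
pose U := undup (map snd l).
(* The Kronecker delta is factored through the distinct indices of [l], so that the double sum
   becomes a sum of squares over [pt n]. *)
have orthU (k k' : R * int) : k' \in l -> pairing L (Q^~ k.2) (Q^~ k'.2) =
    \sum_(n <- U) (k.2 == n)%:R * (k'.2 == n)%:R / pt n.
  move=> k'l; rewrite orthQ (bigD1_seq k'.2) ?undup_uniq//=; last first.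
    by rewrite mem_undup map_f.
  rewrite eqxx mulr1 big1 ?addr0// => n nk.
  by rewrite (eq_sym k'.2) (negPf nk) mulr0 mul0r.
have -> : \sum_(k <- l) \sum_(k' <- l)
      k.1 * (k'.1 * pairing L (Q^~ k.2) (Q^~ k'.2)) =
    \sum_(n <- U) (\sum_(k <- l) k.1 * (k.2 == n)%:R) ^+ 2 / pt n.
  under eq_bigr => k _.
    rewrite big_seq.
    under eq_bigr => k' k'l do rewrite (orthU k k' k'l) !mulr_sumr.
    rewrite -big_seq exchange_big/=; over.
  rewrite exchange_big/=; apply: eq_bigr => n _.
  rewrite expr2 mulr_suml mulr_suml; apply: eq_bigr => k _.
  rewrite mulr_sumr mulr_suml; apply: eq_bigr => k' _; ring.
by apply: sumr_ge0 => n _; rewrite divr_ge0 ?sqr_ge0// ltW.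
Qed.

(** The rows at 0 and -1 are [(1, 0)] and [(0, 1)], so the value at [q ^+ 2] is the pairing of
    [q Q_0] or [q Q_(-1)] with itself. *)
Lemma sqr_functional_ge0 i q : 0 <= L i i (q ^+ 2).
Proof.
have [q1 q2] := Q0; have [q3 q4] := Qm1.
have [->|->] := ord2_cases i.
  have := pairing_row_span_ge0 (row_span_mul q 0); rewrite /pairing !big_ord2.
  by rewrite q1 q2 !(mulr0, mul0r) !(polylin0 linL) !addr0 mulr1 -expr2.
have := pairing_row_span_ge0 (row_span_mul q (-1)); rewrite /pairing !big_ord2.
by rewrite q3 q4 !(mulr0, mul0r) !(polylin0 linL) !add0r mulr1 -expr2.
Qed.

End Squares.

(** * Spectral matrices as functionals on polynomials *)

Section Functional.
Variable R : realType.
Implicit Types (W : mxmeasure R) (p q : {poly R}).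
Local Notation mu := (@lebesgue_measure R).
Local Notation I := (@I11 R).

Lemma I11_0 : I 0.
Proof. by rewrite /I11 /= in_itv /= lerN10 ler01. Qed.

Lemma Rintegral_dirac0 (f : R -> R) : measurable_fun I f ->
  \int[\d_(0 : R)]_(t in I) f t = f 0.
Proof.
move=> mf; rewrite /Rintegral integral_dirac.
- by rewrite diracE mem_set ?mul1e//; exact: I11_0.
- exact: measurable_I11.
- exact/measurable_EFinP.
Qed.

Lemma Rintegral_sum (T : Type) (l : seq T) (F : T -> R -> R) :
  (forall k, mu.-integrable I (EFin \o F k)) ->
  mu.-integrable I (EFin \o (fun t => \sum_(k <- l) F k t)) /\
  \int[mu]_(t in I) (\sum_(k <- l) F k t) =
  \sum_(k <- l) \int[mu]_(t in I) F k t.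
Proof.
move=> iF; elim: l => [|k l [IH1 IH2]].
  under eq_fun do rewrite big_nil.
  split; first exact: integrable0.
  by rewrite big_nil Rintegral_cst ?mul0r//; exact: measurable_I11.
split.
  have := @integrableD _ _ _ mu _ (@measurable_I11 R) _ _ (iF k) IH1.
  by congr integrable; apply/funext => t /=; rewrite big_cons.
rewrite big_cons -IH2.
rewrite -(@RintegralD _ _ _ mu _ _ _ (@measurable_I11 R) (iF k) IH1).
by apply: eq_Rintegral => t _; rewrite big_cons.
Qed.

Definition ac_integrable W :=
  forall i j : 'I_2, mu.-integrable I (fun t => (ac W t i j)%:E).

Definition functional W (i j : 'I_2) p : R :=
  integral_entry W i j (fun t => p.[t]).

Lemma functionalE W i j p : functional W i j p =
  \int[mu]_(t in I) (p.[t] * ac W t i j) + p.[0] * at0 W i j.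
Proof.
rewrite /functional /integral_entry Rintegral_dirac0//; exact: measurable_poly.
Qed.

Lemma functional_lin W : ac_integrable W -> polylin (functional W).
Proof.
move=> iW i j k p q; rewrite !functionalE.
have ip := integrable_horner p (iW i j).
have iq := integrable_horner q (iW i j).
have ikp := integrable_horner (k *: p) (iW i j).
rewrite (@eq_Rintegral _ _ _ mu I (fun t =>
  k * (p.[t] * ac W t i j) + q.[t] * ac W t i j)); last first.
  by move=> t _; rewrite hornerD hornerZ mulrDl mulrA.
rewrite RintegralD//; last 2 first.
- exact: measurable_I11.
- move: ikp; congr integrable; apply/funext => t /=; by rewrite hornerZ mulrA.
rewrite RintegralZl//; last exact: measurable_I11.
by rewrite hornerD hornerZ; ring.
Qed.

Section Sandwich.
Variables (W : mxmeasure R) (A B : R -> 'M[R]_2).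
Variables (PA PB : 'I_2 -> 'I_2 -> {poly R}).
Hypothesis iW : ac_integrable W.
Hypothesis AE : forall t i j, A t i j = (PA i j).[t].
Hypothesis BE : forall t i j, B t i j = (PB i j).[t].

(** Stated for any matrix [M], this serves both the density at [t] and the atom at 0. *)
Lemma sandwich_entry (M : 'M[R]_2) t i j p :
  p.[t] * (A t *m M *m (B t)^T) i j =
  \sum_k \sum_l (PA i k * p * PB j l).[t] * M k l.
Proof.
rewrite mxE mulr_sumr.
under eq_bigr => l _ do rewrite !mxE mulr_suml mulr_sumr.
rewrite exchange_big/=; apply: eq_bigr => k _; apply: eq_bigr => l _.
by rewrite AE BE !hornerM; ring.
Qed.

Let summand_integrable i j p k :
  mu.-integrable I
    (EFin \o (fun t => \sum_l (PA i k * p * PB j l).[t] * ac W t k l)).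
Proof. by apply Rintegral_sum => l; exact (integrable_horner _ (iW k l)). Qed.

Lemma ac_integrable_sandwich : ac_integrable (mxsandwich A W B).
Proof.
move=> i j.
have [+ _] := Rintegral_sum (index_enum _) (summand_integrable i j 1).
congr integrable; apply/funext => t /=; congr EFin.
by rewrite -sandwich_entry hornerE mul1r.
Qed.

Lemma functional_sandwich i j p : functional (mxsandwich A W B) i j p =
  \sum_k \sum_l functional W k l (PA i k * p * PB j l).
Proof.
rewrite functionalE /= sandwich_entry.
under [X in X + _]eq_Rintegral => t _ do rewrite sandwich_entry.
have [_ ->] := Rintegral_sum (index_enum _) (summand_integrable i j p).
rewrite -big_split; apply: eq_bigr => k _.
have [|_ ->] := @Rintegral_sum _ (index_enum _)
    (fun l t => (PA i k * p * PB j l).[t] * ac W t k l).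
  by move=> l; exact (integrable_horner _ (iW k l)).
by rewrite -big_split; apply: eq_bigr => l _; rewrite functionalE.
Qed.

End Sandwich.

Lemma functional_pairing W u v : pairing (functional W) u v =
  \sum_i \sum_j integral_entry W i j (fun t => (u i).[t] * (v j).[t]).
Proof.
apply: eq_bigr => i _; apply: eq_bigr => j _; congr integral_entry.
by apply/funext => t; rewrite hornerM.
Qed.

Lemma mxintegralE W i j : mxintegral W i j = functional W i j 1.
Proof.
rewrite mxE /functional; congr integral_entry.
by apply/funext => t; rewrite hornerE.
Qed.

Lemma indic_entry_ge0 W i : ac_integrable W ->
  (forall q, 0 <= functional W i i (q ^+ 2)) ->
  forall A : set R, measurable A -> 0 <= integral_entry W i i \1_A.
Proof.
move=> iW hq A mA; rewrite /integral_entry Rintegral_dirac0.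
  apply: (@integral_indic_ge0 _ (fun t => ac W t i i) _ (iW i i)) => //.
  by move=> q; rewrite -functionalE.
exact: measurable_indic.
Qed.

End Functional.

(** * Entries of the products of the two factors *)

Section Factors.
Variable R : realType.
Implicit Types (a b c x y s r : int -> R).

Lemma tridiag_far a b c n :
  tridiag a b c (n + 1) (n - 1) = 0 /\ tridiag a b c (n - 1) (n + 1) = 0.
Proof. by split; apply: tridiag_out; rewrite !inE; lia. Qed.

Lemma tridiag_lower a b c n : tridiag a b c (n + 1) n = c (n + 1).
Proof. by have [_ _] := tridiagE a b c (n + 1); rewrite addrK. Qed.

Lemma tridiag_upper a b c n : tridiag a b c (n - 1) n = a (n - 1).
Proof. by have [+ _ _] := tridiagE a b c (n - 1); rewrite subrK. Qed.

Lemma PU_PL x y s r n : [/\ mulZ (PU y x) (PL s r) n (n + 1) = x n * s (n + 1),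
  mulZ (PU y x) (PL s r) n n = x n * r (n + 1) + y n * s n &
  mulZ (PU y x) (PL s r) n (n - 1) = y n * r n].
Proof.
rewrite !mulZ_tridiag /PL tridiag_lower.
have [-> _] := tridiag_far (fun=> 0) s r n.
have [_ -> _] := tridiagE (fun=> 0) s r (n + 1).
have [-> -> ->] := tridiagE (fun=> 0) s r n.
by split; rewrite !(mulr0, mul0r, addr0, add0r).
Qed.

Lemma darbouxE x y s r n : [/\ darboux x y s r n (n + 1) = s n * x n,
  darboux x y s r n n = r n * x (n - 1) + s n * y n &
  darboux x y s r n (n - 1) = r n * y (n - 1)].
Proof.
rewrite /darboux !mulZ_tridiag /PU tridiag_upper.
have [_ ->] := tridiag_far x y (fun=> 0) n.
have [_ -> _] := tridiagE x y (fun=> 0) (n - 1).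
have [-> -> ->] := tridiagE x y (fun=> 0) n.
by split; rewrite !(mulr0, mul0r, addr0, add0r)// addrC.
Qed.

End Factors.

(** * The measure [PsiS] as a functional *)

Section PsiS.
Variable R : realType.
Variables (y s r : int -> R) (Psi : R -> 'M[R]_2).
Local Notation mu := (@lebesgue_measure R).
Local Notation I := (@I11 R).
Hypothesis iPsi : ac_integrable (MxMeasure Psi 0).
Hypothesis hM : forall i j : 'I_2,
  mu.-integrable I (fun t => (Psi t i j / t)%:E).
Hypothesis Psi_sym : forall t, I t -> (Psi t)^T = Psi t.

Lemma functional_density i j p :
  functional (MxMeasure Psi 0) i j p = \int[mu]_(t in I) (p.[t] * Psi t i j).
Proof. by rewrite functionalE /= mxE mulr0 addr0. Qed.

Lemma ac_PsiS t i j : ac (PsiS y s r Psi) t i j = y 0 / s 0 * (Psi t i j / t).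
Proof. by rewrite /= !mxE (mulrC t^-1). Qed.

Lemma PsiS_integrable : ac_integrable (PsiS y s r Psi).
Proof.
move=> i j; have := integrable_horner (y 0 / s 0)%:P (hM i j).
by congr integrable; apply/funext => t; rewrite ac_PsiS /= hornerC.
Qed.

Lemma functional_PsiS i j p : functional (PsiS y s r Psi) i j p =
  y 0 / s 0 * \int[mu]_(t in I) (p.[t] * (Psi t i j / t)) +
  p.[0] * (mx2 (1 / s 0) 0 0 (1 / r 0) i j
    - y 0 / s 0 * \int[mu]_(t in I) (Psi t i j / t)).
Proof.
rewrite functionalE.
rewrite (@eq_Rintegral _ _ _ mu I
  (fun t => y 0 / s 0 * (p.[t] * (Psi t i j / t)))).
  rewrite (@RintegralZl _ _ _ mu); last 2 first.
  - exact: measurable_I11.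
  - exact: (integrable_horner p (hM i j)).
  by rewrite /= !mxE.
by move=> t _; rewrite ac_PsiS mulrCA.
Qed.

(** The [M_(-1)] term of the atom cancels the integral of the density. *)
Lemma functional_PsiS1 i j :
  functional (PsiS y s r Psi) i j 1 = mx2 (1 / s 0) 0 0 (1 / r 0) i j.
Proof.
rewrite functional_PsiS hornerC mul1r.
rewrite (@eq_Rintegral _ _ _ mu I (fun t => Psi t i j / t)).
  by rewrite addrC subrK.
by move=> t _; rewrite hornerC mul1r.
Qed.

(** [X p] vanishes at the atom, and [X] cancels the factor [1/x] of the density. *)
Lemma functional_PsiSX i j p : functional (PsiS y s r Psi) i j ('X * p) =
  y 0 / s 0 * functional (MxMeasure Psi 0) i j p.
Proof.
rewrite functional_PsiS hornerM hornerX !mul0r addr0 functional_density.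
congr (_ * _); rewrite /Rintegral; congr fine.
apply: ae_eq_integral.
- exact: measurable_I11.
- exact: measurable_int (integrable_horner ('X * p) (hM i j)).
- exact: measurable_int (integrable_horner p (iPsi i j)).
(* At [t = 0] the inverse is 0 by convention and nothing cancels, but one point is null. *)
- apply: (@ae_off_null _ [set 0]) => //; first exact: lebesgue_measure_set1.
  move=> t t0 _; rewrite hornerM hornerX; congr EFin; field.
  exact/eqP.
Qed.

Lemma functional_PsiS_sym i j p :
  functional (PsiS y s r Psi) i j p = functional (PsiS y s r Psi) j i p.
Proof.
have PsiC t : t \in I -> Psi t i j = Psi t j i.
  by rewrite inE => It; rewrite -[in LHS](Psi_sym It) mxE.
rewrite !functional_PsiS.
rewrite (@eq_Rintegral _ _ _ mu I (fun t => p.[t] * (Psi t j i / t))); last first.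
  by move=> t /PsiC ->.
rewrite (@eq_Rintegral _ _ _ mu I
  (fun t => Psi t j i / t) (fun t => Psi t i j / t)); last first.
  by move=> t /PsiC ->.
have -> : mx2 (1 / s 0) 0 0 (1 / r 0) i j = mx2 (1 / s 0) 0 0 (1 / r 0) j i.
  by rewrite !mxE; case: (i == 0); case: (j == 0).
by [].
Qed.

Lemma at0_PsiS_sym : (at0 (PsiS y s r Psi))^T = at0 (PsiS y s r Psi).
Proof.
apply/matrixP => i j; rewrite mxE.
(* Writing the atom as total mass minus the integral of the density reduces its symmetry to that of
   the functional and of [Psi]. *)
have E k l : at0 (PsiS y s r Psi) k l = functional (PsiS y s r Psi) k l 1
  - y 0 / s 0 * Mneg1 Psi k l by rewrite functional_PsiS1 !mxE.
rewrite !E functional_PsiS_sym; congr (_ - _ * _); rewrite !mxE.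
apply: eq_Rintegral => t; rewrite inE => It.
by rewrite -[in LHS](Psi_sym It) mxE.
Qed.

Lemma ac_PsiS_sym t : I t ->
  (ac (PsiS y s r Psi) t)^T = ac (PsiS y s r Psi) t.
Proof.
move=> It; apply/matrixP => i j; rewrite mxE !ac_PsiS.
by rewrite -[in LHS](Psi_sym It) mxE.
Qed.

End PsiS.

(** * Matrix form of orthogonality, and the theorem *)

Lemma congruence_sym (R : comNzRingType) n (A M : 'M[R]_n) :
  M^T = M -> (A *m M *m A^T)^T = A *m M *m A^T.
Proof. by move=> MT; rewrite !trmx_mul trmxK MT mulmxA. Qed.

Definition Qpoly (R : realType) (Q : 'I_2 -> int -> {poly R}) (n : int)
    (i j : 'I_2) : {poly R} := Q j (if i == 0 then n else - n - 1).

Lemma QmxE (R : realType) (Q : 'I_2 -> int -> {poly R}) n t i j :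
  Qmx Q n t i j = (Qpoly Q n i j).[t].
Proof.
rewrite /Qmx /Qpoly !mxE.
by have [->|->] := ord2_cases i; have [->|->] := ord2_cases j.
Qed.

(** Entry [(i, j)] pairs the row of index [n] or [- n - 1] with that of index [m] or [- m - 1].
    Nonnegative and negative indices never meet, so off-diagonal entries vanish. *)
Lemma mxintegral_orthogonal (R : realType) (W : mxmeasure R)
    (Q : 'I_2 -> int -> {poly R}) (p : int -> R) (n m : nat) :
  ac_integrable W ->
  (forall i j, pairing (functional W) (Q^~ i) (Q^~ j) = (i == j)%:R / p j) ->
  mxintegral (mxsandwich (Qmx Q n%:Z) W (Qmx Q m%:Z)) =
  (n == m)%:R *: mx2 (1 / p n%:Z) 0 0 (1 / p (- n%:Z - 1)).
Proof.
move=> iW orthQ; apply/matrixP => i j.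
rewrite mxintegralE (functional_sandwich iW (QmxE Q n) (QmxE Q m)).
transitivity (pairing (functional W) (Qpoly Q n i) (Qpoly Q m j)).
  by apply: eq_bigr => k _; apply: eq_bigr => l _; rewrite mulr1.
rewrite orthQ !mxE.
have [->|->] := ord2_cases i; have [->|->] := ord2_cases j => /=.
- rewrite eqz_nat.
  by have [<-|nm] := eqVneq n m; rewrite ?mul1r // !mul0r.
- have -> : (n%:Z == - m%:Z - 1) = false by apply/eqP; lia.
  by rewrite mulr0 mul0r.
- have -> : (- n%:Z - 1 == m%:Z) = false by apply/eqP; lia.
  by rewrite mulr0 mul0r.
- have -> : (- n%:Z - 1 == - m%:Z - 1) = (n == m) by apply/eqP/eqP; lia.
  by have [<-|nm] := eqVneq n m; rewrite ?mul1r // !mul0r.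
Qed.

Theorem theorem3p5 (R : realType) (a b c x y s r : int -> R)
    (Q Qt : 'I_2 -> int -> {poly R}) (Psi : R -> 'M[R]_2)
    (hP : random_walk a b c)
    (hQ : walk_polys (tridiag a b c) Q)
    (hPsi : spectral_matrix (potential (tridiag a b c)) Q (MxMeasure Psi 0))
    (hUL : stochastic_UL (tridiag a b c) x y s r)
    (hQt : walk_polys (darboux x y s r) Qt)
    (hM : forall i j : 'I_2, lebesgue_measure.-integrable (@I11 R)
            (fun t => (Psi t i j / t)%:E)) :
  spectral_matrix (potential (darboux x y s r)) Qt (Psi_tilde x y s r Psi) /\
  forall n m : nat,
    mxintegral (mxsandwich (Qmx Qt n%:Z) (Psi_tilde x y s r Psi)
                           (Qmx Qt m%:Z)) =
    (n == m)%:R *: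
      mx2 (1 / potential (darboux x y s r) n%:Z) 0
          0 (1 / potential (darboux x y s r) (- n%:Z - 1)).
Proof.
have [hsum hpos hPUL] := hUL.
have [Q0 Qm1 recQ] := hQ; have [Qt0 Qtm1 recQt] := hQt.
have [iPsi [Psi_sym _] _ orthQ] := hPsi.
have x_gt0 n : 0 < x n by have [/andP[]] := hpos n.
have y_gt0 n : 0 < y n by have [_ /andP[]] := hpos n.
have s_gt0 n : 0 < s n by have [_ _ /andP[]] := hpos n.
have r_gt0 n : 0 < r n by have [_ _ _ /andP[]] := hpos n.
have x0 n : x n != 0 by rewrite gt_eqF.
have y0 n : y n != 0 by rewrite gt_eqF.
have s0 n : s n != 0 by rewrite gt_eqF.
have r0 n : r n != 0 by rewrite gt_eqF.
have [_ sr1] := hsum 0.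
have PE n : [/\ tridiag a b c n (n + 1) = x n * s (n + 1),
    tridiag a b c n n = x n * r (n + 1) + y n * s n &
    tridiag a b c n (n - 1) = y n * r n] by rewrite !hPUL; exact: PU_PL.
have P_up n : 0 < tridiag a b c n (n + 1).
  by have [-> _ _] := PE n; rewrite mulr_gt0.
have P_down n : 0 < tridiag a b c n (n - 1).
  by have [_ _ ->] := PE n; rewrite mulr_gt0.
have Pt_up n : 0 < darboux x y s r n (n + 1).
  by have [-> _ _] := darbouxE x y s r n; rewrite mulr_gt0.
have Pt_down n : 0 < darboux x y s r n (n - 1).
  by have [_ _ ->] := darbouxE x y s r n; rewrite mulr_gt0.
have recQ' i n : 'X * Q i n = (x n * s (n + 1)) *: Q i (n + 1)
    + (x n * r (n + 1) + y n * s n) *: Q i n + (y n * r n) *: Q i (n - 1).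
  by rewrite recQ; have [-> -> ->] := PE n.
have recQt' i n : 'X * Qt i n = (s n * x n) *: Qt i (n + 1)
    + (r n * x (n - 1) + s n * y n) *: Qt i n
    + (r n * y (n - 1)) *: Qt i (n - 1).
  by rewrite recQt; have [-> -> ->] := darbouxE x y s r n.
set p := potential (tridiag a b c) in orthQ *.
set pt := potential (darboux x y s r).
have p_gt0 n : 0 < p n by exact: potential_gt0.
have pt_gt0 n : 0 < pt n by exact: potential_gt0.
have pS n : p (n + 1) * (y (n + 1) * r (n + 1)) = p n * (x n * s (n + 1)).
  have := @potentialS _ (tridiag a b c) n.
  have [-> _ _] := PE n; have [_ _] := PE (n + 1); rewrite addrK => ->.
  by apply=> k; rewrite gt_eqF.
have ptS n : pt (n + 1) * (r (n + 1) * y n) = pt n * (s n * x n).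
  have := @potentialS _ (darboux x y s r) n.
  have [-> _ _] := darbouxE x y s r n.
  have [_ _] := darbouxE x y s r (n + 1); rewrite addrK => ->.
  by apply=> k; rewrite gt_eqF.
have p0 : p 0 = 1 by rewrite /p /= !big_geq// divr1.
have pt0 : pt 0 = 1 by rewrite /pt /= !big_geq// divr1.
pose W := PsiS y s r Psi.
have iW : ac_integrable W by exact: PsiS_integrable.
have gramS n m : pairing (functional W) (Spoly s r Q n) (Spoly s r Q m) =
    (n == m)%:R / pt m.
  apply: (@gram _ x y s r x0 y0 s0 r0 p pt p0 pt0 _ _ pS ptS Q Q0 Qm1 recQ'
    (functional (MxMeasure Psi 0)) (functional W)) => //.
  - by move=> k; rewrite gt_eqF.
  - by move=> k; rewrite gt_eqF.
  - exact: functional_lin.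
  - exact: functional_lin.
  - by move=> i j q; apply: functional_PsiS_sym.
  - by move=> i j q; apply: functional_PsiSX.
  - by move=> i j; apply: functional_PsiS1.
  - by move=> k l; rewrite functional_pairing orthQ.
have S0E t i j := S0polyE x y s r t i j.
have iWt : ac_integrable (Psi_tilde x y s r Psi).
  exact: (ac_integrable_sandwich iW S0E S0E).
have orthQt n m : pairing (functional (Psi_tilde x y s r Psi))
    (Qt^~ n) (Qt^~ m) = (n == m)%:R / pt m.
  (* Since [Qt_n S_0 = S_n], pairing [Qt] rows for the congruent measure is pairing [S] rows for
     [W]. *)
  rewrite -gramS.
  transitivity (pairing (functional W)
      (fun k => \sum_i Qt i n * S0poly x y s r i k)
      (fun l => \sum_j Qt j m * S0poly x y s r j l)).
    rewrite -(pairing_mul (functional_lin iW)).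
    apply: eq_bigr => i _; apply: eq_bigr => j _.
    exact: (functional_sandwich iW S0E S0E).
  by congr pairing; apply/funext => i; apply: Qt_mul_S0.
split; last by move=> n m; exact: mxintegral_orthogonal.
split.
- exact: iWt.
- split=> [t It|]; apply: congruence_sym; first exact: ac_PsiS_sym.
  exact: at0_PsiS_sym.
(* Orthogonality of [Qt] gives positivity on squares, which passes to indicators of measurable
   sets. *)
- move=> i A mA; apply: indic_entry_ge0 => // q.
  apply: (sqr_functional_ge0 recQt' Qt0 Qtm1 _ orthQt) => //.
  exact: functional_lin.
- by move=> n m; rewrite -functional_pairing orthQt.
Qed.
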